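(* Let $n\ge2$, $i\in\{1,\dots,n-1\}$ and $a\in\mathbb Q$, and let $\mathfrak T_{i,\cdot}$ denote either of the two families of operators $\mathfrak T^{R}_{i,\cdot}$, $\mathfrak T^{L}_{i,\cdot}$ on $\mathbb Z[z_1^{\pm1},\dots,z_n^{\pm1},y]$. If $a\notin\mathbb Z$, then $\mathfrak T_{i,-a}\circ\mathfrak T_{i,a}=-y\,\mathrm{id}$. If $a\in\mathbb Z$, then $\mathfrak T_{i,1-a}\circ\mathfrak T_{i,a}=-y\,\mathrm{id}$.
   Context: For $i\in\{1,\dots,n-1\}$ put $L_i=z_{i+1}/z_i$, and let $s_i$ act on Laurent polynomials $f\in\mathbb Z[z_1^{\pm1},\dots,z_n^{\pm1},y]$ by exchanging $z_i$ and $z_{i+1}$. For $a\in\mathbb Q$ define operators on $\mathbb Z[z_1^{\pm1},\dots,z_n^{\pm1},y]$ by $$\mathfrak T^{R}_{i,a}(f)=-\frac{(1+y)L_i^{\lceil a\rceil}f-(1+yL_i^{-1})\,s_if}{1-L_i},\qquad \mathfrak T^{L}_{i,a}(f)=-\frac{(1+y)L_i^{\lceil a\rceil}f-(1+yL_i)\,s_if}{1-L_i}$$ (the numerators are divisible by $1-L_i$). *)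

(* Defs.v *)
From HB Require Import structures.
From mathcomp Require Import all_boot all_order all_fingroup all_algebra.
From mathcomp Require Import generic_quotient.
From mathcomp Require Import boolp.
From mathcomp Require Import mpoly.
From mathcomp Require Import ring.

Set Implicit Arguments.
Unset Strict Implicit.
Unset Printing Implicit Defensive.

Import GRing.Theory Num.Theory.
Local Open Scope ring_scope.
Local Open Scope quotient_scope.

Notation "x %:F" := (FracField.tofrac x) : ring_scope.

(* Z[y][z_1, ..., z_n] and its field of fractions. The variables z_1, ..., z_n
   are indexed by 'I_n, so that z_k is the variable of index k - 1. *)
Notation zpoly n := {mpoly {poly int}[n]}.
Notation zfrac n := {fraction {mpoly {poly int}[n]}}.

(* Applies g to numerator and denominator; for an injective ring morphism g the
   result does not depend on the representative (lift_fracE). *)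
Definition lift_frac (R S : idomainType) (g : R -> S) (f : {fraction R}) :
  {fraction S} := (g \n_(repr f))%:F / (g \d_(repr f))%:F.

Lemma frac_numden (R : idomainType) (f : {fraction R}) :
  f = (\n_(repr f))%:F / (\d_(repr f))%:F.
Proof.
apply: (mulIf (x := (\d_(repr f))%:F)).
  by rewrite tofrac_eq0 denom_ratioP.
rewrite mulfVK ?tofrac_eq0 ?denom_ratioP //.
rewrite -{1}[f]reprK; move: (repr f) => r.
unlock FracField.tofrac; rewrite -[LHS]FracField.pi_mul.
apply/eqmodP; rewrite /= /FracField.equivf /FracField.mulf.
by rewrite !numden_Ratio ?mulf_neq0 ?oner_eq0 ?denom_ratioP // !mulr1 mulrC.
Qed.

Section LiftFrac.
Variables (R S : idomainType) (g : {rmorphism R -> S}).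
Hypothesis g_inj : injective g.

Let g_neq0 (d : R) : d != 0 -> g d != 0.
Proof. by rewrite -(rmorph0 g) (inj_eq g_inj). Qed.

Lemma lift_fracE (p q : R) : q != 0 ->
  lift_frac g (p%:F / q%:F) = (g p)%:F / (g q)%:F.
Proof.
move=> q0; rewrite /lift_frac; set r := repr _.
have d0 : \d_r != 0 by exact: denom_ratioP.
have /eqP := frac_numden (p%:F / q%:F); rewrite -/r.
rewrite eqr_div ?tofrac_eq0 // -!rmorphM /= tofrac_eq => /eqP pq.
apply/eqP; rewrite eqr_div ?tofrac_eq0 ?g_neq0 //.
by rewrite -!rmorphM /= tofrac_eq; move/(congr1 g): pq; rewrite !rmorphM => ->.
Qed.

Lemma lift_frac_tofrac (p : R) : lift_frac g p%:F = (g p)%:F.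
Proof.
by have := lift_fracE p (oner_neq0 R); rewrite !rmorph1 !divr1.
Qed.

Lemma lift_frac_is_zmod_morphism : zmod_morphism (lift_frac g).
Proof.
move=> u v; rewrite (frac_numden u) (frac_numden v).
move: (repr u) (repr v) => a b.
have [a0 b0] : \d_a != 0 /\ \d_b != 0 by split; exact: denom_ratioP.
rewrite -mulNr addf_div ?tofrac_eq0 // mulNr -!(rmorphM, rmorphB) /=.
rewrite !lift_fracE ?mulf_neq0 // -[X in _ = _ + X]mulNr addf_div ?tofrac_eq0 ?g_neq0 //.
by rewrite mulNr !(rmorphM, rmorphB).
Qed.

Lemma lift_frac_is_monoid_morphism : monoid_morphism (lift_frac g).
Proof.
split=> [|u v]; first by rewrite -tofrac1 lift_frac_tofrac rmorph1.
rewrite (frac_numden u) (frac_numden v).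
move: (repr u) (repr v) => a b.
have [a0 b0] : \d_a != 0 /\ \d_b != 0 by split; exact: denom_ratioP.
rewrite mulf_div -!rmorphM /= !lift_fracE ?mulf_neq0 //.
by rewrite mulf_div !rmorphM.
Qed.
End LiftFrac.

Section ExactDivision.
Variables (F : fieldType) (S : subringClosed F) (s : {rmorphism F -> F}) (L : F).
Hypothesis sS : forall f, f \in S -> s f \in S.
Hypotheses (L0 : L != 0) (L1 : 1 - L != 0) (LS : L \in S) (LVS : L^-1 \in S).

Lemma exprz_in (e : int) : L ^ e \in S.
Proof.
case: e => k; first by rewrite -exprnP rpredX.
by rewrite NegzE -exprnN -exprVn rpredX.
Qed.

Lemma dvd_exprz (e : int) : (L ^ e - 1) / (1 - L) \in S.
Proof.
have dvdn (k : nat) : (L ^+ k - 1) / (1 - L) \in S.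
  rewrite subrX1 -(opprB 1) !mulNr mulrAC mulfV // mul1r.
  by rewrite rpredN rpred_sum // => j _; rewrite rpredX.
case: e => k; first exact: dvdn.
rewrite NegzE -exprnN.
have -> : L ^- k.+1 - 1 = - (L ^- k.+1 * (L ^+ k.+1 - 1)).
  by rewrite mulrBr mulVf ?expf_neq0 // mulr1 opprB.
rewrite mulNr rpredN -mulrA; apply: rpredM; last exact: dvdn.
by rewrite -exprVn rpredX.
Qed.

Definition dvd_diff f : Prop := (f - s f) / (1 - L) \in S.

Lemma dvd_diffD f g : dvd_diff f -> dvd_diff g -> dvd_diff (f + g).
Proof.
move=> df dg; rewrite /dvd_diff rmorphD opprD addrACA mulrDl.
exact: rpredD.
Qed.

Lemma dvd_diffM f g : f \in S -> g \in S ->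
  dvd_diff f -> dvd_diff g -> dvd_diff (f * g).
Proof.
move=> lf lg df dg; rewrite /dvd_diff.
have -> : (f * g - s (f * g)) / (1 - L)
    = (f - s f) / (1 - L) * g + s f * ((g - s g) / (1 - L)).
  by rewrite rmorphM; field.
by apply: rpredD; apply: rpredM => //; apply: sS.
Qed.

Lemma dvd_diff_id f : s f = f -> dvd_diff f.
Proof. by move=> E; rewrite /dvd_diff E subrr mul0r rpred0. Qed.

Lemma dvd_diff_prod (I : Type) (r : seq I) (G : I -> F) :
  (forall j, G j \in S) -> (forall j, dvd_diff (G j)) ->
  dvd_diff (\prod_(j <- r) G j).
Proof.
move=> GS dG.
suff [] : \prod_(j <- r) G j \in S /\ dvd_diff (\prod_(j <- r) G j) by [].
elim/big_rec: _ => [|j f _ [lf df]].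
  by split; [exact: rpred1 | apply: dvd_diff_id; rewrite rmorph1].
by split; [exact: rpredM | exact: dvd_diffM].
Qed.

Lemma dvd_diffX f k : f \in S -> dvd_diff f -> dvd_diff (f ^+ k).
Proof.
by move=> fS df; rewrite -[k]subn0 -prodr_const_nat; apply: dvd_diff_prod.
Qed.

Lemma dvd_diffV f : f != 0 -> f^-1 \in S -> dvd_diff f -> dvd_diff f^-1.
Proof.
move=> f0 fVS df; rewrite /dvd_diff.
have sf0 : s f != 0 by rewrite fmorph_eq0.
have -> : (f^-1 - s f^-1) / (1 - L)
    = - ((f - s f) / (1 - L) * (f^-1 * s (f^-1))).
  by rewrite fmorphV; field; rewrite L1 f0 sf0.
by rewrite rpredN; apply: rpredM => //; apply: rpredM => //; apply: sS.
Qed.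

Lemma dvd_numerator y f (e e' : int) : y \in S -> f \in S -> dvd_diff f ->
  - (((1 + y) * L ^ e * f - (1 + y * L ^ e') * s f) / (1 - L)) \in S.
Proof.
move=> yS fS df.
have -> : - (((1 + y) * L ^ e * f - (1 + y * L ^ e') * s f) / (1 - L))
  = y * s f * ((L ^ e' - 1) / (1 - L))
    - (1 + y) * ((L ^ e - 1) / (1 - L) * f + (f - s f) / (1 - L)).
  by move: (L ^ e) (L ^ e') => u v; field.
have sfS := sS fS.
have dL := dvd_exprz e; have dL' := dvd_exprz e'.
apply: rpredB; first by apply: rpredM => //; apply: rpredM.
apply: rpredM; first by rewrite rpredD ?rpred1.
by apply: rpredD => //; apply: rpredM.
Qed.

End ExactDivision.

Section Laurent.
Variable n : nat.
Implicit Types (p q : zpoly n) (m k : 'X_{1..n}) (f : zfrac n).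

Definition fracXm m : zfrac n := ('X_[m])%:F.
Definition fracX (j : 'I_n) : zfrac n := ('X_j)%:F.
Definition fracY : zfrac n := ('X%:MP)%:F.

Lemma fracXm_neq0 m : fracXm m != 0.
Proof.
rewrite /fracXm tofrac_eq0; apply/eqP => /(congr1 (mcoeff m)).
by rewrite mcoeffX eqxx mcoeff0 => /eqP; rewrite oner_eq0.
Qed.

Lemma fracX_neq0 j : fracX j != 0.
Proof. exact: fracXm_neq0. Qed.

Lemma fracXmD m k : fracXm (m + k)%MM = fracXm m * fracXm k.
Proof. by rewrite /fracXm mpolyXD rmorphM. Qed.

(* The Laurent polynomial ring Z[z_1^{+-1}, ..., z_n^{+-1}, y] is realized as
   the subring of the field of fractions consisting of the p / z^m. *)
Definition islaurent : {pred zfrac n} :=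
  fun f => `[< exists p m, f = p%:F / fracXm m >].

Lemma islaurentP f : reflect (exists p m, f = p%:F / fracXm m) (f \in islaurent).
Proof. exact: asboolP. Qed.

Lemma islaurent_subring : subring_closed islaurent.
Proof.
split=> [|_ _ /islaurentP[p [m ->]] /islaurentP[q [k ->]]
         |_ _ /islaurentP[p [m ->]] /islaurentP[q [k ->]]].
- by apply/islaurentP; exists 1, 0%MM; rewrite /fracXm mpolyX0 rmorph1 divr1.
- apply/islaurentP; exists (p * 'X_[k] - q * 'X_[m]), (m + k)%MM.
  rewrite fracXmD rmorphB !rmorphM /= -/(fracXm k) -/(fracXm m).
  by rewrite -[in LHS]mulNr addf_div ?fracXm_neq0 // mulNr.
- apply/islaurentP; exists (p * q), (m + k)%MM.
  by rewrite fracXmD rmorphM mulf_div.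
Qed.

HB.instance Definition _ :=
  GRing.isSubringClosed.Build (zfrac n) islaurent islaurent_subring.

Record laurent := Laurent {
  laurent_val :> zfrac n;
  laurentP : laurent_val \in islaurent
}.
HB.instance Definition _ := [isSub for laurent_val].
HB.instance Definition _ := [Choice of laurent by <:].
HB.instance Definition _ := [SubChoice_isSubComNzRing of laurent by <:].


Lemma laurent_Xm m : fracXm m \in islaurent.
Proof.
by apply/islaurentP; exists 'X_[m], 0%MM; rewrite {2}/fracXm mpolyX0 rmorph1 divr1.
Qed.

Lemma laurent_XmV m : (fracXm m)^-1 \in islaurent.
Proof. by apply/islaurentP; exists 1, m; rewrite rmorph1 div1r. Qed.

Lemma laurent_poly p : p%:F \in islaurent.
Proof.
by apply/islaurentP; exists p, 0%MM; rewrite /fracXm mpolyX0 rmorph1 divr1.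
Qed.

Definition laurentY : laurent := Laurent (laurent_poly ('X%:MP)).

(* frac_sym s sends z_j to z_(s j) and fixes y (frac_symX, frac_symY). *)
Definition frac_sym (s : 'S_n) : zfrac n -> zfrac n := lift_frac (@msym n _ s).

HB.instance Definition _ s := GRing.isZmodMorphism.Build (zfrac n) (zfrac n)
  (frac_sym s) (lift_frac_is_zmod_morphism (@inj_msym n _ s)).
HB.instance Definition _ s := GRing.isMonoidMorphism.Build (zfrac n) (zfrac n)
  (frac_sym s) (lift_frac_is_monoid_morphism (@inj_msym n _ s)).

Lemma frac_sym_poly s p : frac_sym s p%:F = (msym s p)%:F.
Proof. exact: (lift_frac_tofrac (@inj_msym n _ s)). Qed.

Lemma frac_symX s j : frac_sym s (fracX j) = fracX (s j).
Proof.
rewrite frac_sym_poly msymX /fracX; congr (('X_[_])%:F).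
apply/mnmP => k; rewrite mnmE !mnm1E.
by congr (nat_of_bool _); apply/eqP/eqP => [->|<-]; rewrite ?permKV ?permK.
Qed.

Lemma frac_symY s : frac_sym s fracY = fracY.
Proof. by rewrite frac_sym_poly /msym mmapC. Qed.

Lemma frac_sym_laurent s f : f \in islaurent -> frac_sym s f \in islaurent.
Proof.
case/islaurentP=> p [m ->]; apply/islaurentP.
exists (msym s p), [multinom m ((s^-1)%g j) | j < n].
by rewrite fmorph_div /= !frac_sym_poly msymX.
Qed.

(* i : 'I_n.-1 is a 0-based index: in the 1-based numbering of the variables,
   fracX (idx i) is z_{i+1} and fracX (idxS i) is z_{i+2}. *)
Lemma idx_subproof (i : 'I_n.-1) : (i < n)%N.
Proof. exact: leq_trans (ltn_ord i) (leq_pred n). Qed.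
Lemma idxS_subproof (i : 'I_n.-1) : (i.+1 < n)%N.
Proof. by rewrite -ltn_predRL. Qed.
Definition idx (i : 'I_n.-1) : 'I_n := Ordinal (idx_subproof i).
Definition idxS (i : 'I_n.-1) : 'I_n := Ordinal (idxS_subproof i).

Implicit Types (i : 'I_n.-1) (a : rat) (e : int).

Definition fracL i : zfrac n := fracX (idxS i) / fracX (idx i).

Definition swap i : zfrac n -> zfrac n := frac_sym (tperm (idx i) (idxS i)).
HB.instance Definition _ i := GRing.RMorphism.on (swap i).

Lemma swapK i : involutive (swap i).
Proof.
move=> f; rewrite (frac_numden f); move: (repr f) => r.
have d0 : \d_r != 0 by exact: denom_ratioP.
have inj := @inj_msym n {poly int} (tperm (idx i) (idxS i)).
have E p q : q != 0 -> swap i (p%:F / q%:F) =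
    (msym (tperm (idx i) (idxS i)) p)%:F / (msym (tperm (idx i) (idxS i)) q)%:F.
  by move=> q0; exact: (lift_fracE inj p q0).
apply: etrans (congr1 (swap i) (E _ _ d0)) _; apply: etrans (E _ _ _) _.
  by rewrite -(msym0 _ (tperm (idx i) (idxS i))) (inj_eq inj).
by rewrite -!msymMm tperm2 !msym1m.
Qed.

Lemma swapL i : swap i (fracL i) = (fracL i)^-1.
Proof.
have -> : swap i (fracL i) = swap i (fracX (idxS i)) / swap i (fracX (idx i)).
  exact: fmorph_div.
by rewrite /swap !frac_symX tpermL tpermR /fracL [RHS]invf_div.
Qed.

Lemma swapY i : swap i fracY = fracY.
Proof. exact: frac_symY. Qed.

(* The quotient by 1 - L_i is taken in the field of fractions; divisibility of
   the numerators in the Laurent ring is laurent_TR and laurent_TL below. *)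
Definition fracTR i a f : zfrac n :=
  - (((1 + fracY) * fracL i ^ Num.ceil a * f
      - (1 + fracY * (fracL i)^-1) * swap i f) / (1 - fracL i)).

Definition fracTL i a f : zfrac n :=
  - (((1 + fracY) * fracL i ^ Num.ceil a * f
      - (1 + fracY * fracL i) * swap i f) / (1 - fracL i)).

Lemma fracX_inj : injective fracX.
Proof.
move=> j k /eqP; rewrite tofrac_eq => /eqP /(congr1 (mcoeff U_(k))).
rewrite !mcoeffX eqxx; have [E _|_ /eqP] := eqVneq U_(j)%MM U_(k)%MM.
  move: (congr1 (fun m : 'X_{1..n} => m k) E); rewrite !mnm1E eqxx.
  by case: eqP.
by rewrite eq_sym oner_eq0.
Qed.

Lemma fracL_neq0 i : fracL i != 0.
Proof. by rewrite mulf_neq0 ?invr_eq0 ?fracX_neq0. Qed.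

Lemma fracL_neq1 i : 1 - fracL i != 0.
Proof.
rewrite subr_eq0 eq_sym; apply/eqP => /(divr1_eq) /fracX_inj /(congr1 val) /=.
by move/eqP; rewrite eqn_leq ltnn.
Qed.

Lemma laurent_X j : fracX j \in islaurent.
Proof. exact: laurent_Xm. Qed.

Lemma laurent_L i : fracL i \in islaurent.
Proof. by rewrite rpredM ?laurent_X ?laurent_XmV. Qed.

Lemma laurent_LV i : (fracL i)^-1 \in islaurent.
Proof. by rewrite invf_div rpredM ?laurent_X ?laurent_XmV. Qed.

Lemma laurent_fracY : fracY \in islaurent.
Proof. exact: laurent_poly. Qed.

Lemma dvd_swapX i j : dvd_diff islaurent (swap i) (fracL i) (fracX j).
Proof.
have E : fracX (idx i) - fracX (idxS i) = fracX (idx i) * (1 - fracL i).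
  by rewrite mulrBr mulr1 mulrC divfK ?fracX_neq0.
case: (tpermP (idx i) (idxS i) j) (frac_symX (tperm (idx i) (idxS i)) j)
  => [->|->|_ _] Ej; last exact: dvd_diff_id.
  by rewrite /dvd_diff /= /swap Ej E mulfK ?fracL_neq1 ?laurent_X.
rewrite /dvd_diff /= /swap Ej -opprB E mulNr mulfK ?fracL_neq1 //.
by rewrite rpredN laurent_X.
Qed.

Lemma dvd_swapXm i m : dvd_diff islaurent (swap i) (fracL i) (fracXm m).
Proof.
have sS f : f \in islaurent -> swap i f \in islaurent.
  exact: frac_sym_laurent.
rewrite /fracXm mpolyXE_id rmorph_prod /=; apply: dvd_diff_prod.
- exact: sS.
- exact: fracL_neq1.
- by move=> j; exact: laurent_poly.
move=> j; rewrite rmorphXn; apply: dvd_diffX.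
- exact: sS.
- exact: fracL_neq1.
- exact: laurent_poly.
exact: dvd_swapX.
Qed.

Lemma dvd_swap_poly i p : dvd_diff islaurent (swap i) (fracL i) p%:F.
Proof.
have sS f : f \in islaurent -> swap i f \in islaurent.
  exact: frac_sym_laurent.
elim/mpolyind: p => [|c m p _ _ IH].
  by apply: dvd_diff_id; rewrite !rmorph0.
rewrite rmorphD; apply: dvd_diffD; last exact: IH.
rewrite -mul_mpolyC rmorphM; apply: dvd_diffM.
- exact: sS.
- exact: fracL_neq1.
- exact: laurent_poly.
- exact: laurent_poly.
- by apply: dvd_diff_id; rewrite /= /swap frac_sym_poly /msym mmapC.
exact: dvd_swapXm.
Qed.

Lemma dvd_swap_laurent i f :
  f \in islaurent -> dvd_diff islaurent (swap i) (fracL i) f.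
Proof.
have sS g : g \in islaurent -> swap i g \in islaurent.
  exact: frac_sym_laurent.
case/islaurentP=> p [m ->]; apply: dvd_diffM.
- exact: sS.
- exact: fracL_neq1.
- exact: laurent_poly.
- exact: laurent_XmV.
- exact: dvd_swap_poly.
apply: dvd_diffV.
- exact: sS.
- exact: fracL_neq1.
- exact: fracXm_neq0.
- exact: laurent_XmV.
exact: dvd_swapXm.
Qed.

Lemma laurent_numerator i f e e' : f \in islaurent ->
  - (((1 + fracY) * fracL i ^ e * f
      - (1 + fracY * fracL i ^ e') * swap i f) / (1 - fracL i)) \in islaurent.
Proof.
move=> lf; apply: dvd_numerator.
- by move=> g; exact: frac_sym_laurent.
- exact: fracL_neq0.
- exact: fracL_neq1.
- exact: laurent_L.
- exact: laurent_LV.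
- exact: laurent_fracY.
- exact: lf.
exact: dvd_swap_laurent.
Qed.

Lemma laurent_TR i a f : f \in islaurent -> fracTR i a f \in islaurent.
Proof. exact: (laurent_numerator i (Num.ceil a) (-1)). Qed.

Lemma laurent_TL i a f : f \in islaurent -> fracTL i a f \in islaurent.
Proof. exact: (laurent_numerator i (Num.ceil a) 1). Qed.

Definition laurentTR i a (f : laurent) : laurent :=
  Laurent (laurent_TR i a (laurentP f)).

Definition laurentTL i a (f : laurent) : laurent :=
  Laurent (laurent_TL i a (laurentP f)).

End Laurent.

(* Main.v *)
Require Import Defs.
From mathcomp Require Import all_boot all_order all_fingroup all_algebra.
From mathcomp Require Import ring.
Import GRing.Theory Num.Theory.
Local Open Scope ring_scope.

(** The rational number [a] enters only through its ceiling, and both cases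
    compose the operators with exponents [e] and [1 - e]
    ([ceil_opp_nonint], [ceil_1sub_int]).  For two such exponents, since [s]
    is an involution inverting [L], the two contributions to the coefficient
    of [s f] in the composite cancel, while that of [f] is
      [- L * ((1 + y * M) * (1 + y / M) - (1 + y)^2) / (1 - L)^2
        = - y * L * (M + 1/M - 2) / (1 - L)^2]
    with [M = 1/L] for the right operators and [M = L] for the left ones.
    This expression is symmetric in [M] and [1/M], so both families give
    [- y], because [L * (L + 1/L - 2) = (1 - L)^2] ([demazure_lusztig_comp]). *)

(** Modelled on an arbitrary field with an endomorphism, so that one
    computation serves for both families and all Laurent polynomials. *)
Definition demazure_lusztig {F : fieldType} (s : F -> F) (y L M : F) (e : int)
    (f : F) : F :=
  - (((1 + y) * L ^ e * f - (1 + y * M) * s f) / (1 - L)).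

(** The exponent [1 - e] is what makes the coefficient of [s f] vanish:
    applying [s] turns [L ^ e] into [L ^ - e] and [1 / (1 - L)] into
    [- L / (1 - L)], so both contributions carry [L ^ (1 - e)]. *)
Lemma demazure_lusztig_comp (F : fieldType) (s : {rmorphism F -> F})
    (y L M : F) (e : int) (f : F) :
  involutive s -> s y = y -> s L = L^-1 -> L != 0 -> 1 - L != 0 ->
  M = L^-1 \/ M = L ->
  demazure_lusztig s y L M (1 - e) (demazure_lusztig s y L M e f) = - y * f.
Proof.
move=> sK sy sL L0 L1 hM.
have sM : s M = M^-1 by case: hM => ->; rewrite ?fmorphV sL.
have L1' : L - 1 != 0 by rewrite -opprB oppr_eq0.
have LX0 : L ^ e != 0 by rewrite expfz_neq0.
rewrite /demazure_lusztig expfzDr // expr1z -invr_expz.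
rewrite rmorphN fmorph_div !rmorphB !rmorphM !rmorphD !rmorphM !rmorph1 /=.
rewrite sK sy sM sL rmorphXz /= ?sL ?unitfE // exprz_inv -invr_expz.
(* Only [s f] and the value of [L ^ e] matter now: the identity is rational. *)
move: (L ^ e) LX0 (s f) => u u0 g.
by case: hM => ->; field; rewrite ?L0 ?L1 ?L1' ?u0 ?oner_eq0.
Qed.

Lemma ceil_opp_nonint (a : rat) :
  a \isn't a Num.int -> Num.ceil (- a) = 1 - Num.ceil a.
Proof.
move=> aZ; rewrite ceilNfloor opprK [Num.ceil a]ceil_floor (negbTE aZ) /=.
by rewrite opprD addrCA subrr addr0.
Qed.

Lemma ceil_1sub_int (a : rat) :
  a \is a Num.int -> Num.ceil (1 - a) = 1 - Num.ceil a.
Proof. by case/intrP=> k ->; rewrite -[1]/(1%:~R) -rmorphB /= !intrKceil. Qed.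

Lemma laurentT_comp (n : nat) (i : 'I_n.-1) (a b : rat)
    (T : 'I_n.-1 -> rat -> laurent n -> laurent n) :
  T = @laurentTR n \/ T = @laurentTL n -> Num.ceil b = 1 - Num.ceil a ->
  T i b \o T i a =1 (fun f : laurent n => - laurentY n * f).
Proof.
move=> hT ab f; apply: val_inj; rewrite rmorphM rmorphN /=.
have comp M := @demazure_lusztig_comp _ (swap i) (fracY n) (fracL i) M
  (Num.ceil a) (laurent_val f) (swapK i) (swapY i) (swapL i) (fracL_neq0 i) (fracL_neq1 i).
case: hT => ->; rewrite /= /fracTR /fracTL ab.
  by apply: comp; left.
by apply: comp; right.
Qed.

Theorem lemma11p1 (n : nat) (hn : (2 <= n)%N) (i : 'I_n.-1) (a : rat)
    (T : 'I_n.-1 -> rat -> laurent n -> laurent n)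
    (hT : T = @laurentTR n \/ T = @laurentTL n) :
  (a \isn't a Num.int ->
     T i (- a) \o T i a =1 (fun f : laurent n => - laurentY n * f)) /\
  (a \is a Num.int ->
     T i (1 - a) \o T i a =1 (fun f : laurent n => - laurentY n * f)).
Proof.
split=> aZ; apply: laurentT_comp => //.
  exact: ceil_opp_nonint.
exact: ceil_1sub_int.
Qed.
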